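(* Let $A$ be a residuated lattice and $s:A\rightarrow[0,1]$ a Bosbach state, and let $\tilde{A}_s$, $\tilde{s}$, $\varphi_s$ be as constructed in the context. For any residuated lattice $C$, any faithful Bosbach state $m:C\rightarrow[0,1]$ such that $(C,\delta_m)$ is a Cauchy-complete metric space, and any residuated lattice morphism $f:A\rightarrow C$ such that $m\circ f=s$, there exists a unique residuated lattice morphism $\tilde{f}:\tilde{A}_s\rightarrow C$ such that $m\circ\tilde{f}=\tilde{s}$ and $\tilde{f}\circ\varphi_s=f$.
   Context: A residuated lattice is an algebra $(A,\vee,\wedge,\odot,\rightarrow,0,1)$ such that $(A,\vee,\wedge,0,1)$ is a bounded lattice, $(A,\odot,1)$ is a commutative monoid, and for all $a,b,c\in A$: $a\leq b\rightarrow c$ iff $a\odot b\leq c$. Write $d_A(a,b)=(a\rightarrow b)\wedge(b\rightarrow a)$. Morphisms preserve all operations and constants. A Bosbach state on $A$ is a function $s:A\rightarrow[0,1]$ with $s(0)=0$, $s(1)=1$ and $1+s(a\wedge b)=s(a)+s(a\rightarrow b)$ for all $a,b\in A$. It is faithful iff $s(a)=1$ implies $a=1$. Put $\rho_s(a,b)=s(d_A(a,b))$ and $\delta_s(a,b)=1-\rho_s(a,b)$; $\delta_s$ is a pseudo-metric on $A$, and it is a metric iff $s$ is faithful. Construction: $\mathcal{C}_s(A)$ is the set of Cauchy sequences of the pseudo-metric space $(A,\delta_s)$, with residuated lattice operations defined termwise. For $\underline{a}=(a_n)_{n\geq0},\underline{b}=(b_n)_{n\geq0}\in\mathcal{C}_s(A)$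 put $\underline{a}\sim\underline{b}$ iff $\lim_{n\rightarrow\infty}\delta_s(a_n,b_n)=0$; this is a congruence, and $\tilde{A}_s=\mathcal{C}_s(A)/_{\sim}$ is the quotient residuated lattice, with $\tilde{\underline{a}}$ denoting the class of $\underline{a}$. The function $\tilde{s}:\tilde{A}_s\rightarrow[0,1]$ is (well) defined by $\tilde{s}(\tilde{\underline{a}})=\lim_{n\rightarrow\infty}s(a_n)$, and $\varphi_s:A\rightarrow\tilde{A}_s$ sends $a\in A$ to the class of the constant sequence $(a)_{n\geq0}$. *)

(* Defs.v *)
From HB Require Import structures.
From mathcomp Require Import all_boot all_order all_algebra.
From mathcomp Require Import lra.
From mathcomp Require Import all_classical all_reals all_analysis.
Set Implicit Arguments.
Unset Strict Implicit.
Unset Printing Implicit Defensive.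
Import Order.TTheory GRing.Theory Num.Theory.
Import numFieldNormedType.Exports.
Local Open Scope quotient_scope.
Local Open Scope ring_scope.

(* The bounded lattice is the library's; 0 and 1 are \bot and \top. *)
HB.mixin Record isResiduated d A of Order.TBLattice d A := {
  rmul : A -> A -> A;
  rimp : A -> A -> A;
  rmulA : associative rmul;
  rmulC : commutative rmul;
  rmul1x : left_id \top%O rmul;
  residuation : forall a b c : A, (a <= rimp b c)%O = (rmul a b <= c)%O
}.

#[short(type="residuatedLatticeType")]
HB.structure Definition ResiduatedLattice d :=
  { A of isResiduated d A & Order.TBLattice d A }.

Declare Scope rl_scope.
Delimit Scope rl_scope with RL.
Open Scope rl_scope.
Notation "x ⊙ y" := (rmul x y) (at level 40, left associativity) : rl_scope.
Notation "x ⇒ y" := (rimp x y) (at level 55, right associativity) : rl_scope.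

Section ResiduatedTheory.
Context {d : Order.disp_t} {A : residuatedLatticeType d}.
Implicit Types a b c x y z : A.
Local Open Scope order_scope.

Definition rdist a b : A := (a ⇒ b) `&` (b ⇒ a).

Lemma rmulx1 a : a ⊙ \top = a. Proof. by rewrite rmulC rmul1x. Qed.

Lemma rmul_mp a b : (a ⇒ b) ⊙ a <= b. Proof. by rewrite -residuation. Qed.

Lemma rmul_le2r a b c : a <= b -> a ⊙ c <= b ⊙ c.
Proof. by move=> ab; rewrite -residuation (le_trans ab)// residuation. Qed.

Lemma rmul_le2l a b c : a <= b -> c ⊙ a <= c ⊙ b.
Proof. by rewrite ![c ⊙ _]rmulC; exact: rmul_le2r. Qed.

Lemma rmul_lel a b : a ⊙ b <= a.
Proof. by rewrite -[leRHS]rmulx1 rmul_le2l// lex1. Qed.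

Lemma rmul_ler a b : a ⊙ b <= b. Proof. by rewrite rmulC rmul_lel. Qed.

Lemma rimp_le a b : a <= b -> (a ⇒ b) = \top.
Proof.
by move=> ab; apply/eqP; rewrite eq_le lex1 /= residuation rmul1x.
Qed.

Lemma rdistC a b : rdist a b = rdist b a. Proof. exact: meetC. Qed.

Lemma rdistxx a : rdist a a = \top. Proof. by rewrite /rdist meetxx rimp_le. Qed.

Lemma rdistx1 a : rdist a \top = a.
Proof.
rewrite /rdist rimp_le ?lex1// meet1x; apply/eqP; rewrite eq_le.
by rewrite residuation rmulx1 lexx andbT -[leLHS]rmulx1 rmul_mp.
Qed.

Lemma rdist_eq1 a b : rdist a b = \top -> a = b.
Proof.
move=> ab; apply/eqP; rewrite eq_le -[X in X <= _]rmul1x -[X in _ && (X <= _)]rmul1x.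
by rewrite -!residuation -lexI -/(rdist a b) ab lexx.
Qed.

Lemma rmul_dist a b : a ⊙ rdist a b <= b.
Proof. by rewrite rmulC -residuation leIl. Qed.

Lemma rdistP a b x : a ⊙ x <= b -> b ⊙ x <= a -> x <= rdist a b.
Proof. by rewrite lexI !residuation ![x ⊙ _]rmulC => -> ->. Qed.

Lemma rdist_trans a b c : rdist a b ⊙ rdist b c <= rdist a c.
Proof.
apply: rdistP; rewrite rmulA.
  by apply: le_trans (rmul_dist b c); rewrite rmul_le2r// rmul_dist.
rewrite -rmulA [X in c ⊙ X]rmulC rmulA.
apply: le_trans (rmul_dist b a); rewrite [rdist b a]rdistC.
by apply: rmul_le2r; rewrite rdistC rmul_dist.
Qed.

Lemma rdist_op (op : A -> A -> A) :
  (forall a a' b b' x y, a ⊙ x <= a' -> a' ⊙ x <= a -> b ⊙ y <= b' ->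
     b' ⊙ y <= b -> op a b ⊙ (x ⊙ y) <= op a' b') ->
  forall a a' b b', rdist a a' ⊙ rdist b b' <= rdist (op a b) (op a' b').
Proof.
move=> H a a' b b'; have D u v : v ⊙ rdist u v <= u by rewrite rdistC rmul_dist.
by apply: rdistP; apply: H; rewrite ?rmul_dist ?D.
Qed.

Lemma rdist_meet a a' b b' :
  rdist a a' ⊙ rdist b b' <= rdist (a `&` b) (a' `&` b').
Proof.
apply: (rdist_op (op := fun a b => a `&` b)) => {}a {}a' {}b {}b' x y ax _ by_ _.
rewrite lexI; apply/andP; split.
  apply: le_trans ax; apply: le_trans (rmul_le2r _ (leIl a b)) _.
  by rewrite rmul_le2l// rmul_lel.
apply: le_trans by_; apply: le_trans (rmul_le2r _ (leIr b a)) _.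
by rewrite rmul_le2l// rmul_ler.
Qed.

Lemma rdist_join a a' b b' :
  rdist a a' ⊙ rdist b b' <= rdist (a `|` b) (a' `|` b').
Proof.
apply: (rdist_op (op := fun a b => a `|` b)) => {}a {}a' {}b {}b' x y ax _ by_ _.
rewrite -residuation leUx !residuation; apply/andP; split.
  apply: le_trans (leUl _ _); apply: le_trans ax.
  by rewrite rmul_le2l// rmul_lel.
apply: le_trans (leUr _ _); apply: le_trans by_.
by rewrite rmul_le2l// rmul_ler.
Qed.

Lemma rmulACA : interchange (@rmul d A) (@rmul d A).
Proof. by move=> a b x y; rewrite -!rmulA; congr rmul; rewrite !rmulA [b ⊙ x]rmulC. Qed.

Lemma rdist_mul a a' b b' :
  rdist a a' ⊙ rdist b b' <= rdist (a ⊙ b) (a' ⊙ b').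
Proof.
apply: (rdist_op (op := rmul)) => {}a {}a' {}b {}b' x y ax _ by_ _.
by rewrite rmulACA (le_trans (rmul_le2r _ ax))// rmul_le2l.
Qed.

Lemma rdist_imp a a' b b' :
  rdist a a' ⊙ rdist b b' <= rdist (a ⇒ b) (a' ⇒ b').
Proof.
apply: (rdist_op (op := rimp)) => {}a {}a' {}b {}b' x y _ ax by_ _.
rewrite residuation -rmulA [x ⊙ y ⊙ a']rmulC [a' ⊙ _]rmulA rmulA.
apply: le_trans by_; apply: rmul_le2r.
by rewrite (le_trans (rmul_le2l _ ax))// rmul_mp.
Qed.

End ResiduatedTheory.

Section Morphism.
Context {d d' : Order.disp_t}.
Context {A : residuatedLatticeType d} {B : residuatedLatticeType d'}.

Record rl_morphism (f : A -> B) : Prop := RLMorphism {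
  rl_morph_join : Order.join_morphism f;
  rl_morph_meet : Order.meet_morphism f;
  rl_morph_mul : {morph f : a b / a ⊙ b};
  rl_morph_imp : {morph f : a b / a ⇒ b};
  rl_morph_bot : f \bot%O = \bot%O;
  rl_morph_top : f \top%O = \top%O
}.

End Morphism.

Section Metric.
Context {R : realType} {T : Type}.
Implicit Types (D : T -> T -> R) (u : nat -> T).

Record is_pseudo_metric D : Prop := IsPseudoMetric {
  pseudo_metric_ge0 : forall a b, 0 <= D a b;
  pseudo_metric_xx : forall a, D a a = 0;
  pseudo_metric_sym : forall a b, D a b = D b a;
  pseudo_metric_triangle : forall a b c, D a c <= D a b + D b c
}.

Definition is_metric D : Prop :=
  is_pseudo_metric D /\ forall a b, D a b = 0 -> a = b.

Definition cauchy_seq D u : Prop :=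
  forall e : R, 0 < e ->
    exists N, forall m n, (N <= m)%N -> (N <= n)%N -> D (u m) (u n) < e.

Definition converges_to D u (l : T) : Prop :=
  ((fun n => D (u n) l) @ \oo --> (0 : R))%classic.

Definition complete_metric D : Prop :=
  is_metric D /\ forall u, cauchy_seq D u -> exists l, converges_to D u l.

End Metric.

Record bosbachState (R : realType) d (A : residuatedLatticeType d) :=
  BosbachState {
    bosbach_fun :> A -> R;
    bosbach_itv : forall a, 0 <= bosbach_fun a <= 1;
    bosbach0 : bosbach_fun \bot%O = 0;
    bosbach1 : bosbach_fun \top%O = 1;
    bosbachP : forall a b,
      1 + bosbach_fun (a `&` b)%O = bosbach_fun a + bosbach_fun (a ⇒ b)
  }.

Section Bosbach.
Context {R : realType} {d : Order.disp_t} {A : residuatedLatticeType d}.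
Variable s : bosbachState R A.
Implicit Types a b c : A.

Definition faithful : Prop := forall a, s a = 1 -> a = \top%O.

Definition rho a b : R := s (rdist a b).

Definition delta a b : R := 1 - rho a b.

Lemma bosbach_le1 a : s a <= 1.
Proof. by have /andP[] := bosbach_itv s a. Qed.

Lemma bosbach_ge0 a : 0 <= s a.
Proof. by have /andP[] := bosbach_itv s a. Qed.

Lemma bosbach_mono a b : (a <= b)%O -> s a <= s b.
Proof.
move=> ab; have := bosbachP s b a; rewrite (meet_idPr ab).
by have := bosbach_le1 (b ⇒ a); lra.
Qed.

Lemma bosbach_mul a b : s a + s b - 1 <= s (a ⊙ b).
Proof.
have := bosbachP s a (a ⊙ b); rewrite (meet_idPr (rmul_lel a b)).
have : (b <= a ⇒ a ⊙ b)%O by rewrite residuation rmulC.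
by move=> /bosbach_mono; lra.
Qed.

Lemma delta_of_le a b c x y : (rdist a b ⊙ rdist c x <= y)%O ->
  1 - s y <= delta a b + delta c x.
Proof.
move=> /bosbach_mono; rewrite /delta /rho.
by have := bosbach_mul (rdist a b) (rdist c x); lra.
Qed.

Lemma delta_ge0 a b : 0 <= delta a b.
Proof. by rewrite subr_ge0 bosbach_le1. Qed.

Lemma deltaxx a : delta a a = 0.
Proof. by rewrite /delta /rho rdistxx bosbach1 subrr. Qed.

Lemma deltaC a b : delta a b = delta b a.
Proof. by rewrite /delta /rho rdistC. Qed.

Lemma delta_triangle a b c : delta a c <= delta a b + delta b c.
Proof. by apply: delta_of_le; exact: rdist_trans. Qed.

Lemma delta_pseudo_metric : is_pseudo_metric delta.
Proof. by split; [exact: delta_ge0|exact: deltaxx|exact: deltaC|exact: delta_triangle]. Qed.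

Lemma delta_metricP : is_metric delta <-> faithful.
Proof.
split=> [[_ D0] a sa|F].
  by apply: D0; rewrite /delta /rho rdistx1 sa subrr.
split; first exact: delta_pseudo_metric.
move=> a b /eqP; rewrite subr_eq0 eq_sym => /eqP/F; exact: rdist_eq1.
Qed.

Lemma bosbach_delta a b : `|s a - s b| <= delta a b.
Proof.
have H x y : s x - s y <= delta x y.
  have := bosbach_mono (rmul_dist x y); have := bosbach_mul x (rdist x y).
  by rewrite /delta /rho; lra.
by have := H a b; have := H b a; rewrite deltaC ler_norml; lra.
Qed.

Definition delta_compat (op : A -> A -> A) : Prop :=
  forall a a' b b', delta (op a b) (op a' b') <= delta a a' + delta b b'.

Lemma delta_join : delta_compat (fun a b => a `|` b)%O.
Proof. by move=> a a' b b'; apply: delta_of_le; exact: rdist_join. Qed.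

Lemma delta_meet : delta_compat (fun a b => a `&` b)%O.
Proof. by move=> a a' b b'; apply: delta_of_le; exact: rdist_meet. Qed.

Lemma delta_mul : delta_compat (fun a b => a ⊙ b).
Proof. by move=> a a' b b'; apply: delta_of_le; exact: rdist_mul. Qed.

Lemma delta_imp : delta_compat (fun a b => a ⇒ b).
Proof. by move=> a a' b b'; apply: delta_of_le; exact: rdist_imp. Qed.

Record cauchySeq := CauchySeq {
  cseq :> nat -> A;
  cseq_cauchy : cauchy_seq delta cseq
}.

HB.instance Definition _ := gen_eqMixin cauchySeq.
HB.instance Definition _ := gen_choiceMixin cauchySeq.

Implicit Types u v w : cauchySeq.

Lemma cseq_const_subproof a : cauchy_seq delta (fun=> a).
Proof. by move=> e e0; exists 0%N => m n _ _; rewrite deltaxx. Qed.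

Definition cseq_const a : cauchySeq := CauchySeq (cseq_const_subproof a).

Lemma cseq_op_subproof op (opP : delta_compat op) u v :
  cauchy_seq delta (fun n => op (u n) (v n)).
Proof.
move=> e e0; have e20 : 0 < e / 2 by rewrite divr_gt0.
have [N HN] := cseq_cauchy u e20; have [M HM] := cseq_cauchy v e20.
exists (maxn N M) => m n; rewrite !geq_max => /andP[Nm Mm] /andP[Nn Mn].
rewrite (le_lt_trans (opP _ _ _ _))// [ltRHS](splitr e).
by rewrite ltrD// ?HN// HM.
Qed.

Definition cseq_op op (opP : delta_compat op) u v : cauchySeq :=
  CauchySeq (cseq_op_subproof opP u v).

Definition cseq_sim u v : bool :=
  `[< ((fun n => delta (u n) (v n)) @ \oo --> (0 : R))%classic >].

Lemma delta_squeeze (f g : nat -> R) : (forall n, 0 <= f n <= g n) ->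
  (g @ \oo --> (0 : R))%classic -> (f @ \oo --> (0 : R))%classic.
Proof.
move=> fg g0; apply: (squeeze_cvgr (f := cst 0) (h := g)) => //.
  by apply: nearW => n; exact: fg.
exact: cvg_cst.
Qed.

Lemma cvgD0 (f g : nat -> R) : (f @ \oo --> (0 : R))%classic ->
  (g @ \oo --> (0 : R))%classic ->
  ((fun n => f n + g n) @ \oo --> (0 : R))%classic.
Proof. by move=> f0 g0; rewrite -[0](addr0 (0 : R)); exact: cvgD. Qed.

Lemma cseq_sim_refl : reflexive cseq_sim.
Proof.
move=> u; apply/asboolP; under eq_fun do rewrite deltaxx; exact: cvg_cst.
Qed.

Lemma cseq_sim_sym : symmetric cseq_sim.
Proof.
by move=> u v; rewrite /cseq_sim; under eq_fun do rewrite deltaC.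
Qed.

Lemma cseq_sim_trans : transitive cseq_sim.
Proof.
move=> v u w /asboolP uv /asboolP vw; apply/asboolP.
apply: delta_squeeze (cvgD0 uv vw) => n.
by rewrite delta_ge0 delta_triangle.
Qed.

Canonical cseq_sim_equiv :=
  EquivRel cseq_sim cseq_sim_refl cseq_sim_sym cseq_sim_trans.

Lemma cseq_sim_op op (opP : delta_compat op) u u' v v' :
  cseq_sim u u' -> cseq_sim v v' ->
  cseq_sim (cseq_op opP u v) (cseq_op opP u' v').
Proof.
move=> /asboolP uu /asboolP vv; apply/asboolP.
apply: delta_squeeze (cvgD0 uu vv) => n.
by rewrite delta_ge0 opP.
Qed.

Definition completion := {eq_quot cseq_sim}.

HB.instance Definition _ := Choice.on completion.
HB.instance Definition _ := EqQuotient.on completion.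

Definition compl_op op (opP : delta_compat op) : completion -> completion -> completion :=
  lift_op2 completion (cseq_op opP).

Lemma compl_opE op (opP : delta_compat op) u v :
  compl_op opP (\pi u) (\pi v) = \pi_completion (cseq_op opP u v).
Proof.
rewrite /compl_op -lock; apply/eqmodP; apply: cseq_sim_op; apply/eqmodP; exact: reprK.
Qed.

Definition phi a : completion := \pi_completion (cseq_const a).

Definition compl_join := compl_op delta_join.
Definition compl_meet := compl_op delta_meet.
Definition compl_mul := compl_op delta_mul.
Definition compl_imp := compl_op delta_imp.
Definition compl_bot := phi \bot%O.
Definition compl_top := phi \top%O.

Lemma cseq_ext u v : (forall n, u n = v n) -> u = v.
Proof.
case: u v => [u Hu] [v Hv] /= /funext uv; case: v / uv Hv => Hv.
by rewrite (Prop_irrelevance Hu Hv).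
Qed.

Ltac compl_law :=
  rewrite /compl_join /compl_meet /compl_mul /compl_imp /compl_bot /compl_top
    /phi ?compl_opE; congr (\pi_completion _); apply: cseq_ext => n /=.

Lemma compl_joinC : commutative compl_join.
Proof. by elim/quotW=> u; elim/quotW=> v; compl_law; rewrite joinC. Qed.

Lemma compl_joinA : associative compl_join.
Proof.
by elim/quotW=> u; elim/quotW=> v; elim/quotW=> w; compl_law; rewrite joinA.
Qed.

Lemma compl_meetC : commutative compl_meet.
Proof. by elim/quotW=> u; elim/quotW=> v; compl_law; rewrite meetC. Qed.

Lemma compl_meetA : associative compl_meet.
Proof.
by elim/quotW=> u; elim/quotW=> v; elim/quotW=> w; compl_law; rewrite meetA.
Qed.

Lemma compl_meetxx : idempotent_op compl_meet.
Proof. by elim/quotW=> u; compl_law; rewrite meetxx. Qed.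

Lemma compl_joinKI y x : compl_meet x (compl_join x y) = x.
Proof. by elim/quotW: x => u; elim/quotW: y => v; compl_law; rewrite joinKI. Qed.

Lemma compl_meetKU y x : compl_join x (compl_meet x y) = x.
Proof. by elim/quotW: x => u; elim/quotW: y => v; compl_law; rewrite meetKU. Qed.

Definition compl_le (x y : completion) : bool := compl_meet x y == x.

Lemma compl_le_refl : reflexive compl_le.
Proof. by move=> x; rewrite /compl_le compl_meetxx. Qed.

Lemma compl_le_anti : antisymmetric compl_le.
Proof. by move=> x y /andP[/eqP xy /eqP yx]; rewrite -xy compl_meetC. Qed.

Lemma compl_le_trans : transitive compl_le.
Proof.
move=> y x z /eqP xy /eqP yz; apply/eqP.
by rewrite -xy -compl_meetA yz.
Qed.

HB.instance Definition _ := Order.Le_isPOrder.Build d completion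
  compl_le_refl compl_le_anti compl_le_trans.

HB.instance Definition _ := Order.POrder_isLattice.Build d completion
  compl_meetC compl_joinC compl_meetA compl_joinA compl_joinKI compl_meetKU
  (fun _ _ => erefl).

Lemma compl_le0x x : compl_le compl_bot x.
Proof. by rewrite /compl_le; apply/eqP; elim/quotW: x => u; compl_law; rewrite meet0x. Qed.

Lemma compl_lex1 x : compl_le x compl_top.
Proof. by rewrite /compl_le; apply/eqP; elim/quotW: x => u; compl_law; rewrite meetx1. Qed.

HB.instance Definition _ := Order.hasBottom.Build d completion compl_le0x.
HB.instance Definition _ := Order.hasTop.Build d completion compl_lex1.

Lemma compl_mulA : associative compl_mul.
Proof.
by elim/quotW=> u; elim/quotW=> v; elim/quotW=> w; compl_law; rewrite rmulA.
Qed.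

Lemma compl_mulC : commutative compl_mul.
Proof. by elim/quotW=> u; elim/quotW=> v; compl_law; rewrite rmulC. Qed.

Lemma compl_mul1x : left_id (\top%O : completion) compl_mul.
Proof. by elim/quotW=> u; compl_law; rewrite rmul1x. Qed.

Lemma compl_mul_le2r x x' y :
  compl_le x x' -> compl_le (compl_mul x y) (compl_mul x' y).
Proof.
move=> /eqP <-; apply/eqP; elim/quotW: x => u; elim/quotW: x' => u'.
elim/quotW: y => v; compl_law.
by apply/meet_idPl; rewrite rmul_le2r// leIr.
Qed.

Lemma compl_imp_le2l x y y' :
  compl_le y y' -> compl_le (compl_imp x y) (compl_imp x y').
Proof.
move=> /eqP <-; apply/eqP; elim/quotW: x => u; elim/quotW: y => v.
elim/quotW: y' => v'; compl_law.
by apply/meet_idPl; rewrite residuation (le_trans (rmul_mp _ _))// leIr.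
Qed.

Lemma compl_residuation (x y z : completion) :
  compl_le x (compl_imp y z) = compl_le (compl_mul x y) z.
Proof.
have mp : compl_le (compl_mul (compl_imp y z) y) z.
  clear x; apply/eqP; elim/quotW: y => v; elim/quotW: z => w; compl_law.
  by apply/meet_idPl; rewrite rmul_mp.
have pm : compl_le x (compl_imp y (compl_mul x y)).
  clear mp; apply/eqP; elim/quotW: x => u; elim/quotW: y => v; compl_law.
  by apply/meet_idPl; rewrite residuation.
apply/idP/idP => [/(compl_mul_le2r y) /compl_le_trans|/(compl_imp_le2l y)].
  exact.
exact: compl_le_trans.
Qed.

HB.instance Definition _ := isResiduated.Build d completion
  compl_mulA compl_mulC compl_mul1x compl_residuation.

Section Quotient.
Local Open Scope order_scope.

Lemma pi_join u v :
  \pi_completion u `|` \pi_completion v = \pi_completion (cseq_op delta_join u v).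
Proof. exact: compl_opE. Qed.

Lemma pi_meet u v :
  \pi_completion u `&` \pi_completion v = \pi_completion (cseq_op delta_meet u v).
Proof. exact: compl_opE. Qed.

Lemma pi_mul u v :
  \pi_completion u ⊙ \pi_completion v = \pi_completion (cseq_op delta_mul u v).
Proof. exact: compl_opE. Qed.

Lemma pi_imp u v :
  (\pi_completion u ⇒ \pi_completion v) = \pi_completion (cseq_op delta_imp u v).
Proof. exact: compl_opE. Qed.

Lemma pi_bot : \bot = \pi_completion (cseq_const \bot).
Proof. by []. Qed.

Lemma pi_top : \top = \pi_completion (cseq_const \top).
Proof. by []. Qed.

End Quotient.

(* The limit is independent of the representative: see stildeE. *)
Definition stilde (x : completion) : R :=
  lim ((fun n => s (repr x n)) @ \oo)%classic.

Lemma bosbach_cseq_cvg u : cvg ((fun n => s (u n)) @ \oo)%classic.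
Proof.
apply/cauchy_cvgP/cauchy_exP => e e0.
have [N HN] := cseq_cauchy u e0; exists (s (u N)); exists N => // n /= Nn.
by rewrite -ball_normE /= (le_lt_trans (bosbach_delta _ _))// HN.
Qed.

Lemma stilde_cvg u :
  ((fun n => s (u n)) @ \oo --> stilde (\pi u))%classic.
Proof.
have : cseq_sim (repr (\pi_completion u)) u by apply/eqmodP; exact: reprK.
move=> /asboolP ru; rewrite /stilde; set v := repr _ in ru *.
have sub : ((fun n => s (u n) - s (v n)) @ \oo --> (0 : R))%classic.
  apply: norm_cvg0; apply: delta_squeeze ru => n.
  by rewrite normr_ge0 distrC bosbach_delta.
rewrite (_ : (fun n => s (u n)) = (fun n => s (u n) - s (v n)) \+ (s \o v)).
  by rewrite -[X in (_ --> X)%classic]add0r; apply: cvgD => //; exact: bosbach_cseq_cvg.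
by apply/funext => n /=; rewrite subrK.
Qed.

Lemma stildeE u : stilde (\pi u) = lim ((fun n => s (u n)) @ \oo)%classic.
Proof. by apply/esym/cvg_lim; [exact: Rhausdorff|exact: stilde_cvg]. Qed.

End Bosbach.

Arguments phi {R d A} s a.
Arguments stilde {R d A} s x.

(* Main.v *)
Require Import Defs.
From mathcomp Require Import all_boot all_order all_algebra.
From mathcomp Require Import all_classical all_reals all_analysis.
Set Implicit Arguments.
Unset Strict Implicit.
Unset Printing Implicit Defensive.
Import Order.TTheory GRing.Theory Num.Theory.
Import numFieldNormedType.Exports.
Local Open Scope quotient_scope.
Local Open Scope ring_scope.

(** A state-preserving morphism is an isometry, so [f] maps Cauchy sequences of
    [A] to Cauchy sequences of [C], and the class of [u] must be sent to the
    limit of [f (u n)].  The limit exists by completeness, it is the same for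
    equivalent sequences, and passing to the limit preserves the operations
    because they are nonexpansive.  Conversely, [phi (u n)] tends to the class
    of [u], so an isometry extending [f] can take no other value there. *)

(** The constant [D l l'] is squeezed between 0 and [D (u n) l + D (u n) l'], which tends to 0. *)
Lemma converges_to_unique (R : realType) (T : Type) (D : T -> T -> R)
    (u : nat -> T) (l l' : T) : is_metric D ->
  converges_to D u l -> converges_to D u l' -> l = l'.
Proof.
move=> [[D_ge0 _ D_sym D_tri] D_eq0] ul ul'; apply: D_eq0.
have D0 : ((fun=> D l l') @ \oo --> (0 : R))%classic.
  apply: delta_squeeze (cvgD0 ul ul') => n.
  by rewrite D_ge0 (D_sym (u n)) D_tri.
by apply: cvg_unique D0 => //; exact: cvg_cst.
Qed.

Section StateLimits.
Context {R : realType} {d : Order.disp_t} {C : residuatedLatticeType d}.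
Variable m : bosbachState R C.

Lemma converges_to_op op (opP : delta_compat m op) (u v : nat -> C) (l k : C) :
  converges_to (delta m) u l -> converges_to (delta m) v k ->
  converges_to (delta m) (fun n => op (u n) (v n)) (op l k).
Proof.
move=> ul vk; apply: delta_squeeze (cvgD0 ul vk) => n.
by rewrite delta_ge0 opP.
Qed.

Lemma converges_to_cst (l : C) : converges_to (delta m) (fun=> l) l.
Proof. by rewrite /converges_to deltaxx; exact: cvg_cst. Qed.

(** A state is 1-Lipschitz for its own pseudo-metric, hence continuous. *)
Lemma bosbach_converges_to (u : nat -> C) (l : C) :
  converges_to (delta m) u l -> ((fun n => m (u n)) @ \oo --> m l)%classic.
Proof.
move=> ul; apply/subr_cvg0; apply: norm_cvg0; apply: delta_squeeze ul => n.
by rewrite normr_ge0 bosbach_delta.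
Qed.

End StateLimits.

Lemma rl_morph_rdist (d d' : Order.disp_t) (A : residuatedLatticeType d)
    (B : residuatedLatticeType d') (f : A -> B) : rl_morphism f ->
  {morph f : a b / rdist a b}.
Proof. by case=> _ fI _ fi _ _ a b; rewrite /rdist fI !fi. Qed.

(** The map [t] is a bare function so that [stilde s], which is not packaged as a [bosbachState],
    can take its place; [1 - t (rdist a b)] then stands for the distance on the source. *)
Lemma delta_morph (R : realType) (d d' : Order.disp_t)
    (B : residuatedLatticeType d) (C : residuatedLatticeType d')
    (m : bosbachState R C) (g : B -> C) (t : B -> R) (a b : B) :
  rl_morphism g -> m \o g = t -> delta m (g a) (g b) = 1 - t (rdist a b).
Proof. by move=> gM <-; rewrite /delta /rho /= rl_morph_rdist. Qed.

Section Completion.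
Context {R : realType} {d : Order.disp_t} {A : residuatedLatticeType d}.
Variable s : bosbachState R A.

(** Operations on classes are termwise, so [rdist (phi s a) (\pi u)] is the class of
    [rdist a (u k)], along which [s] tends to [stilde s]. *)
Lemma delta_stilde_cvg (a : A) (u : cauchySeq s) :
  ((fun k => delta s a (u k)) @ \oo -->
     1 - stilde s (rdist (phi s a) (\pi u)))%classic.
Proof.
apply: cvgB; first exact: cvg_cst.
by rewrite /rdist /phi !pi_imp pi_meet; exact: stilde_cvg.
Qed.

(** Density of the image of [phi s]: a Cauchy sequence of [A], embedded termwise, converges to its
    own class. *)
Lemma phi_cseq_cvg (u : cauchySeq s) :
  ((fun n => 1 - stilde s (rdist (phi s (u n)) (\pi u))) @ \oo
     --> (0 : R))%classic.
Proof.
have ge0 n : 0 <= 1 - stilde s (rdist (phi s (u n)) (\pi u)).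
  apply: (cvgr_to_ge (@delta_stilde_cvg (u n) u)).
  by apply: nearW => k; exact: delta_ge0.
apply/cvgrPdist_le => e e0.
have [N uN] := cseq_cauchy u e0; exists N => // n /= Nn.
rewrite sub0r normrN ger0_norm//.
(* With [n] fixed, the Cauchy bound on [delta s (u n) (u k)] passes to the limit in [k]. *)
apply: (cvgr_to_le (@delta_stilde_cvg (u n) u)).
  by exists N => // k /= Nk; rewrite ltW// uN.
Qed.

Section Extension.
Context {d' : Order.disp_t} {C : residuatedLatticeType d'}.
Variables (m : bosbachState R C) (f : A -> C).
Hypotheses (f_morphism : rl_morphism f) (m_f : m \o f = s).

Lemma delta_isometry (a b : A) : delta m (f a) (f b) = delta s a b.
Proof. exact: delta_morph. Qed.

Lemma extension_limit (g : completion s -> C) (u : cauchySeq s) :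
  rl_morphism g -> m \o g = stilde s -> g \o phi s = f ->
  converges_to (delta m) (f \o u) (g (\pi u)).
Proof.
move=> gM mg gf; rewrite /converges_to -gf /=.
by under eq_fun do rewrite (delta_morph _ _ gM mg); exact: phi_cseq_cvg.
Qed.

Lemma completion_limit : complete_metric (delta m) ->
  exists g : completion s -> C,
    forall u : cauchySeq s, converges_to (delta m) (f \o u) (g (\pi u)).
Proof.
move=> [_ m_complete].
(* A limit is first chosen along the canonical representative of each class. *)
have /choice[g gP] (x : completion s) : exists l : C,
    converges_to (delta m) (f \o repr x) l.
  apply: m_complete => e /(cseq_cauchy (repr x))[N xN].
  by exists N => i j Ni Nj; rewrite /= delta_isometry xN.
exists g => u; have : cseq_sim u (repr (\pi_(completion s) u)).
  by apply/eqmodP; rewrite reprK.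
(* Any other representative has the same limit, by the triangle inequality through
   [f (repr (\pi u) n)]. *)
move=> /asboolP ur; apply: delta_squeeze (cvgD0 ur (gP (\pi u))) => n.
by rewrite delta_ge0 -delta_isometry delta_triangle.
Qed.

Section LimitMap.
Variable g : completion s -> C.
Hypotheses (m_metric : is_metric (delta m))
  (gP : forall u : cauchySeq s, converges_to (delta m) (f \o u) (g (\pi u))).

Lemma limit_phi (a : A) : g (phi s a) = f a.
Proof.
apply: converges_to_unique (gP _) _ => //.
exact: (converges_to_cst m (f a)).
Qed.

(** Both sides are limits of the sequence [opC (f (u n)) (f (v n))]. *)
Lemma limit_op opA opC (opAP : delta_compat s opA) (opCP : delta_compat m opC)
    (u v : cauchySeq s) : {morph f : a b / opA a b >-> opC a b} ->
  g (\pi_(completion s) (cseq_op opAP u v)) = opC (g (\pi u)) (g (\pi v)).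
Proof.
move=> f_op; apply: converges_to_unique (gP _) _ => //.
rewrite /comp; under eq_fun do rewrite /= f_op.
exact: (converges_to_op opCP (gP u) (gP v)).
Qed.

Lemma limit_morphism : rl_morphism g.
Proof.
split.
- elim/quotW=> u; elim/quotW=> v; rewrite pi_join.
  exact/(limit_op _ (@delta_join _ _ _ m))/rl_morph_join.
- elim/quotW=> u; elim/quotW=> v; rewrite pi_meet.
  exact/(limit_op _ (@delta_meet _ _ _ m))/rl_morph_meet.
- elim/quotW=> u; elim/quotW=> v; rewrite Defs.pi_mul.
  exact/(limit_op _ (@delta_mul _ _ _ m))/rl_morph_mul.
- elim/quotW=> u; elim/quotW=> v; rewrite pi_imp.
  exact/(limit_op _ (@delta_imp _ _ _ m))/rl_morph_imp.
- by rewrite pi_bot limit_phi rl_morph_bot.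
- by rewrite pi_top limit_phi rl_morph_top.
Qed.

Lemma limit_state : m \o g = stilde s.
Proof.
apply/funext; elim/quotW=> u /=.
have s_mg : ((fun n => s (u n)) @ \oo --> m (g (\pi u)))%classic.
  (* Here [s (u n)] is [m (f (u n))], and [f (u n)] tends to [g (\pi u)]. *)
  by rewrite -m_f; exact: bosbach_converges_to (gP u).
by rewrite stildeE; apply/esym/cvg_lim; [exact: Rhausdorff|exact: s_mg].
Qed.

End LimitMap.
End Extension.
End Completion.

Theorem theorem6p25 (R : realType)
    (dA : Order.disp_t) (A : residuatedLatticeType dA) (s : bosbachState R A)
    (dC : Order.disp_t) (C : residuatedLatticeType dC) (m : bosbachState R C)
    (m_faithful : faithful m) (m_complete : complete_metric (delta m))
    (f : A -> C) (f_morphism : rl_morphism f) (m_f : m \o f = s) :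
  exists! g : completion s -> C,
    [/\ rl_morphism g, m \o g = stilde s & g \o phi s = f].
Proof.
have m_metric := m_complete.1.
have [g gP] := completion_limit f_morphism m_f m_complete.
exists g; split=> [|h [hM mh hf]].
  split; [exact: limit_morphism gP|exact: limit_state gP|].
  by apply/funext => a; exact: limit_phi gP a.
(* On the class of [u], both [g] and [h] give the limit of [f (u n)]. *)
apply/funext; elim/quotW=> u; apply: converges_to_unique (gP u) _ => //.
exact: extension_limit.
Qed.
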